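(* In the setting of top and bottom sequences given in the context, fix an index $i$ and assume: (A2) $E_i\hat I_ix_p=I_ix_p$ for all $x_p\in\mathcal P^{k_i}$; (A3) $I_i:\mathcal H_i\to X_i$ is continuous for the norms $\|\cdot\|_{\mathcal H,i}$ and $\|\cdot\|_{X,i}$, with operator norm $\|I_i\|$; and suppose that $(I_iv_p,I_iw_p)_{X,i}=(v_p,w_p)_{\mathcal L,i}$ for all $v_p,w_p\in\mathcal P^{k_i}$. Then: 1. (Polynomial consistency) $(\hat I_iv_p,\hat I_iw_p)_{\hat X,i}=(v_p,w_p)_{\mathcal L,i}$ for all $v_p,w_p\in\mathcal P^{k_i}$. 2. (Consistency in $\mathcal H_i$) Assuming moreover (A1) that $\hat R_i:X_i\to\hat X_i$ is continuous with operator norm $\|\hat R_i\|$, for all $v,w\in\mathcal H_i$, $$\left|(\hat I_iv,\hat I_iw)_{\hat X,i}-(v,w)_{\mathcal L,i}\right|\le\left(\|\hat R_i\|^2\|I_i\|^2+c_{\mathcal H,i}^2\right)\left(\omega_i(v)\|w\|_{\mathcal H,i}+\omega_i(w)\|v\|_{\mathcal H,i}+\omega_i(v)\,\omega_i(w)\right),$$ where $\omega_i(\xi):=\inf_{\xi_p\in\mathcal P^{k_i}}\|\xi-\xi_p\|_{\mathcal H,i}$ for all $\xi\in\mathcal H_i$.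
   Context: $(X_i,d_i)_i$ (top sequence) is a complex of real vector spaces with inner products $(\cdot,\cdot)_{X,i}$ and norms $\|\cdot\|_{X,i}$. $(\hat X_i)_i$ (bottom sequence) is a second sequence of real vector spaces, with linear maps $E_i:\hat X_i\to X_i$ (extensions) and $\hat R_i:X_i\to\hat X_i$ (reductions). The inner product on $\hat X_i$ is $(\hat x,\hat y)_{\hat X,i}:=(E_i\hat x,E_i\hat y)_{X,i}$, with norm $\|\hat x\|_{\hat X,i}=\|E_i\hat x\|_{X,i}$ (it is understood that this is an inner product, i.e. that $E_i$ is injective). For each $i$, $\mathcal H_i$ is a Hilbert space with norm $\|\cdot\|_{\mathcal H,i}$, $\mathcal P^{k_i}\subset\mathcal H_i$ is a (polynomial) linear subspace, and $I_i:\mathcal H_i\to X_i$ is a linear map (interpolator). $\mathcal L_i$ is an ''$L^2$-like'' space with inner product $(\cdot,\cdot)_{\mathcal L,i}$ and norm $\|\cdot\|_{\mathcal L,i}$ in which $\mathcal H_i$ is continuously embedded, with constant $c_{\mathcal H,i}$: $\|v\|_{\mathcal L,i}\le c_{\mathcal H,i}\|v\|_{\mathcal H,i}$ for all $v\in\mathcal H_i$. The interpolator of the bottom sequence is $\hat I_i:=\hat R_iI_i:\mathcal H_i\to\hat X_i$. *)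

(* Defs.v *)
From HB Require Import structures.
From mathcomp Require Import all_boot all_order all_algebra.
From mathcomp Require Import all_classical all_reals all_analysis.

Set Implicit Arguments.
Unset Strict Implicit.
Unset Printing Implicit Defensive.

Import Order.TTheory GRing.Theory Num.Theory.
Import numFieldNormedType.Exports.

Local Open Scope classical_set_scope.
Local Open Scope ring_scope.

(* [{dot V for idfun}] is the type of symmetric positive definite bilinear
   forms on V; the axiom says that the norm (hence the topology) of V is the
   one induced by the form. *)
HB.mixin Record NormedModule_hasInner (R : realType) V
    of NormedModule R V := {
  inner : {dot V for idfun};
  norm_inner : forall x : V, `|x| = Num.sqrt (inner x x)
}.

#[short(type="innerProductType")]
HB.structure Definition InnerProduct (R : realType) :=
  {V of NormedModule R V & NormedModule_hasInner R V}.

#[short(type="hilbertType")]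
HB.structure Definition Hilbert (R : realType) :=
  {V of InnerProduct R V & CompleteNormedModule R V}.

(* Intended for continuous linear [f]: otherwise the set below may be
   unbounded, in which case [sup] returns a junk value. *)
Definition opnorm (R : realType) (V W : normedModType R) (f : V -> W) : R :=
  sup [set `|f x| | x in [set x : V | `|x| <= 1]].

Definition dist_to (R : realType) (V : normedModType R) (P : submodClosed V)
    (x : V) : R :=
  inf [set `|x - y| | y in [set y : V | y \in P]].

(* Complexes that are only indexed by naturals, or by a finite range, are
   covered by taking zero spaces at the other indices. *)
Record sequences (R : realType) := Sequences {
  topX : int -> innerProductType R;
  dtop : forall i, {linear topX i -> topX (i + 1)};
  dtop_dtop : forall i x, dtop (i + 1) (dtop i x) = 0;
  botX : int -> innerProductType R;
  ext : forall i, {linear botX i -> topX i};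
  red : forall i, {linear topX i -> botX i};
  (* This equation determines the inner product, the norm and the topology of
     [botX i], and forces [ext i] to be injective. *)
  inner_bot : forall i (x y : botX i), inner x y = inner (ext i x) (ext i y);
  hilb : int -> hilbertType R;
  polys : forall i, submodClosed (hilb i);
  interp : forall i, {linear hilb i -> topX i};
  Ltwo : int -> innerProductType R;
  emb : forall i, {linear hilb i -> Ltwo i};
  emb_inj : forall i, injective (emb i);
  emb_cst : int -> R;
  emb_bounded : forall i (v : hilb i), `|emb i v| <= emb_cst i * `|v|
}.

Definition bot_interp (R : realType) (S : sequences R) (i : int) :
  hilb S i -> botX S i := red S i \o interp S i.

Arguments bot_interp {R} S i _.

(* Main.v *)
(* The error form B(v, w) = (Î v, Î w) - (v, w)_L is bilinear, vanishes on
   P x P by (A2) and the isometry of I on P, and satisfies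
   |B(v, w)| <= C |v| |w| by Cauchy-Schwarz.  For vp, wp in P this gives
   B(v, w) = B(v - vp, w) + B(v, w - wp) - B(v - vp, w - wp); bound each term,
   then take the infimum over vp and over wp. *)
Require Import Defs.
From HB Require Import structures.
From mathcomp Require Import all_boot all_order all_algebra.
From mathcomp Require Import all_classical all_reals all_analysis.
From mathcomp Require Import ring lra.

Set Implicit Arguments.
Unset Strict Implicit.
Unset Printing Implicit Defensive.

Import Order.TTheory GRing.Theory Num.Theory.
Import numFieldNormedType.Exports.

Local Open Scope classical_set_scope.
Local Open Scope ring_scope.

Lemma innerC (R : realType) (V : innerProductType R) (x y : V) :
  inner x y = inner y x.
Proof. by rewrite (hermC inner) /= expr0 mul1r. Qed.

Lemma inner_norm (R : realType) (V : innerProductType R) (x : V) :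
  inner x x = `|x| ^+ 2.
Proof.
rewrite norm_inner sqr_sqrtr//.
have [->|x0] := eqVneq x 0; first by rewrite linear0l.
exact/ltW/neq0_dnorm_gt0.
Qed.

(** For nonzero [x] and [y], expanding the square of the norm of [|y| x - |x| y] gives
    [2 |x| |y| (|x| |y| - inner x y) >= 0], and [|x| |y|] is positive. *)
Lemma inner_le (R : realType) (V : innerProductType R) (x y : V) :
  inner x y <= `|x| * `|y|.
Proof.
have [->|x0] := eqVneq x 0; first by rewrite linear0l normr0 mul0r.
have [->|y0] := eqVneq y 0; first by rewrite linear0r normr0 mulr0.
have := sqr_ge0 `| `|y| *: x - `|x| *: y |.
rewrite -inner_norm linearBl !linearBr !linearZl_LR !linearZr_LR /= !inner_norm.
rewrite (innerC y x) /GRing.scale /= => h.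
rewrite -(ler_pM2l (mulr_gt0 _ _ : 0 < `|x| * `|y|)) ?normr_gt0//.
nra.
Qed.

Lemma cauchy_schwarz (R : realType) (V : innerProductType R) (x y : V) :
  `|inner x y| <= `|x| * `|y|.
Proof.
rewrite ler_norml inner_le andbT lerNl -linearNl -(normrN x).
exact: inner_le.
Qed.

Lemma opnorm_ge0 (R : realType) (V W : normedModType R) (f : V -> W) :
  0 <= opnorm f.
Proof.
rewrite /opnorm; set E := (X in sup X).
(* Without a supremum, [sup] takes the default value 0; otherwise it dominates some norm. *)
have [supE|noE] := pselect (has_sup E); last by rewrite sup_out.
have [[r Er] _] := supE; apply: le_trans (sup_upper_bound supE Er).
by case: Er => x _ <-.
Qed.

(** Continuity bounds [f] on the unit ball, so the [sup] is a genuine upper bound; it is evaluated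
    at [x / |x|]. *)
Lemma norm_le_opnorm (R : realType) (V W : normedModType R)
    (f : {linear V -> W}) : continuous f ->
  forall x, `|f x| <= opnorm f * `|x|.
Proof.
move=> /linear_bounded_continuous/linear_boundedP/pinfty_ex_gt0[M M0 fM] x.
have [->|x0] := eqVneq x 0; first by rewrite linear0 !normr0 mulr0.
rewrite -ler_pdivrMr ?normr_gt0//.
apply: ub_le_sup; last first.
  exists (`|x|^-1 *: x); last first.
    by rewrite linearZ normrZ normfV normr_id mulrC.
  by rewrite /= normrZ normfV normr_id mulVf ?normr_eq0.
exists M => _ [y /= y1 <-]; apply: (le_trans (fM y)).
by rewrite ler_piMr// ltW.
Qed.

Lemma dist_to_ge0 (R : realType) (V : normedModType R) (P : submodClosed V)
  (x : V) : 0 <= dist_to P x.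
Proof.
apply: lb_le_inf => [|_ [y _ <-]//].
by exists `|x - 0|, 0 => //=; exact: rpred0.
Qed.

(** An upper bound that is affine and nondecreasing in the distance passes to the infimum. Positive
    [k] can be divided out; for [k = 0] the point [y = 0] of [P] suffices. *)
Lemma le_affine_dist_to (R : realType) (V : normedModType R)
    (P : submodClosed V) (x : V) (a b k : R) : 0 <= k ->
  (forall y, y \in P -> a <= k * `|x - y| + b) -> a <= k * dist_to P x + b.
Proof.
rewrite le0r => /predU1P[-> /(_ 0 (rpred0 P))|k0 aP]; first by rewrite !mul0r.
rewrite -lerBlDr mulrC -ler_pdivrMr//; apply: lb_le_inf => [|_ [y Py <-]].
  by exists `|x - 0|, 0 => //=; exact: rpred0.
by rewrite ler_pdivrMr// mulrC lerBlDr aP.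
Qed.

Lemma consistency_error_le (R : realType) (V : normedModType R)
    (X L : innerProductType R) (P : submodClosed V)
    (f : {linear V -> X}) (g : {linear V -> L}) (a c : R) :
    (forall v, `|f v| <= a * `|v|) -> (forall v, `|g v| <= c * `|v|) ->
    (forall v w, v \in P -> w \in P -> inner (f v) (f w) = inner (g v) (g w)) ->
  forall v w, `|inner (f v) (f w) - inner (g v) (g w)| <=
    (a ^+ 2 + c ^+ 2) * (dist_to P v * `|w| + dist_to P w * `|v|
                         + dist_to P v * dist_to P w).
Proof.
move=> fa gc fgP v w; set C := a ^+ 2 + c ^+ 2.
have C0 : 0 <= C by rewrite addr_ge0 ?sqr_ge0.
pose B x y := inner (f x) (f y) - inner (g x) (g y).
have BC x y : `|B x y| <= C * (`|x| * `|y|).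
  apply: (le_trans (ler_normB _ _)); rewrite mulrDl lerD//;
    apply: (le_trans (cauchy_schwarz _ _)); rewrite expr2 mulrACA; exact: ler_pM.
have Bvw vp wp : vp \in P -> wp \in P ->
    `|B v w| <= C * (`|v - vp| * `|w| + `|w - wp| * `|v|
                     + `|v - vp| * `|w - wp|).
  move=> Pv Pw.
  (* The two sides differ exactly by [B vp wp], which is zero by [fgP]. *)
  have -> : B v w = B (v - vp) w + B v (w - wp) - B (v - vp) (w - wp).
    have := fgP _ _ Pv Pw; rewrite /B !(linearB f) !(linearB g) !linearBl !linearBr /=; lra.
  apply: (le_trans (ler_normB _ _)); rewrite !mulrDr lerD//.
  by apply: (le_trans (ler_normD _ _)); apply: lerD; rewrite // (mulrC _ `|v|).
have Bw wp : wp \in P -> `|B v w| <=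
    C * (dist_to P v * `|w| + `|w - wp| * `|v| + dist_to P v * `|w - wp|).
  move=> Pw.
  (* With [wp] fixed, the bound [Bvw] is affine in [|v - vp|], with this nonnegative slope. *)
  rewrite (_ : _ * _ = C * (`|w| + `|w - wp|) * dist_to P v
                       + C * (`|w - wp| * `|v|)); last by ring.
  apply: le_affine_dist_to => [|vp Pv]; first by rewrite mulr_ge0// addr_ge0.
  by apply: le_trans (Bvw _ _ Pv Pw) _; lra.
rewrite -/(B v w).
(* The infimum over [vp] being taken, what remains is affine in [|w - wp|]. *)
rewrite (_ : _ * _ = C * (`|v| + dist_to P v) * dist_to P w
                     + C * (dist_to P v * `|w|)); last by ring.
apply: le_affine_dist_to => [|wp Pw].
  by rewrite mulr_ge0// addr_ge0// dist_to_ge0.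
by apply: le_trans (Bw _ Pw) _; lra.
Qed.

Theorem proposition5 (R : realType) (S : sequences R) (i : int)
  (A2 : forall xp : hilb S i, xp \in polys S i ->
     ext S i (bot_interp S i xp) = interp S i xp)
  (A3 : continuous (interp S i : hilb S i -> topX S i))
  (interp_isometry : forall vp wp : hilb S i,
     vp \in polys S i -> wp \in polys S i ->
     inner (interp S i vp) (interp S i wp) = inner (emb S i vp) (emb S i wp)) :
  (forall vp wp : hilb S i, vp \in polys S i -> wp \in polys S i ->
     inner (bot_interp S i vp) (bot_interp S i wp)
       = inner (emb S i vp) (emb S i wp))
  /\
  (forall A1 : continuous (red S i : topX S i -> botX S i),
     let omega := dist_to (polys S i) in
     forall v w : hilb S i,
       `|inner (bot_interp S i v) (bot_interp S i w)
           - inner (emb S i v) (emb S i w)|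
       <= (opnorm (red S i) ^+ 2 * opnorm (interp S i) ^+ 2 + emb_cst S i ^+ 2)
          * (omega v * `|w| + omega w * `|v| + omega v * omega w)).
Proof.
have consistency vp wp : vp \in polys S i -> wp \in polys S i ->
    inner (bot_interp S i vp) (bot_interp S i wp)
    = inner (emb S i vp) (emb S i wp).
  (* The bottom inner product is computed after extension, where [A2] replaces the extended bottom
     interpolate by the top one. *)
  by move=> Pv Pw; rewrite inner_bot !A2// interp_isometry.
(* Merging the squares exhibits [a = opnorm (red S i) * opnorm (interp S i)], a bound for the
   composite interpolator; [c] is [emb_cst S i]. *)
split=> [//|A1 omega v w]; rewrite -exprMn.
apply: (consistency_error_le (f := red S i \o interp S i)) => [u|u|//].
  apply: (le_trans (norm_le_opnorm A1 _)); rewrite -mulrA ler_wpM2l ?opnorm_ge0//.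
  exact: norm_le_opnorm.
exact: emb_bounded.
Qed.
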